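(* Let $f=[g:g_1,\dots,g_s;h_1,\dots,h_r]$ be a differentiable convertible nonconvex function and let $(\boldsymbol{x}^*,\boldsymbol{y}^* )\in X(g)$. Suppose there is an optimal solution $\boldsymbol{d}^*$ to the linear program $\mathrm{(CNP)}(\boldsymbol{x}^*,\boldsymbol{y}^* )$ such that $\nabla g(\boldsymbol{x}^*,\boldsymbol{y}^* )^\top\boldsymbol{d}^*\ge 0$. Then $(\boldsymbol{x}^*,\boldsymbol{y}^* )$ is an optimal solution to (CNP), $\boldsymbol{x}^*$ is an optimal solution to (UOP), and there are $\boldsymbol{u}^*=(u_1^*,\dots,u_s^* )^\top\ge 0$ and $\boldsymbol{v}^*=(v_1^*,\dots,v_r^* )^\top\ge 0$ such that $$\nabla g(\boldsymbol{x}^*,\boldsymbol{y}^* )+\sum_{i=1}^s u_i^*\nabla g_i(\boldsymbol{x}^*,\boldsymbol{y}^* )+\sum_{j=1}^r v_j^*\nabla h_j(\boldsymbol{x}^*,\boldsymbol{y}^* )=0,\qquad u_i^*g_i(\boldsymbol{x}^*,\boldsymbol{y}^* )=0\ \ (i=1,\dots,s).$$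
   Context: Let $f:R^n\to R$ be nonconvex or nonsmooth and let $g,g_i,h_j:R^n\times R^m\to R$ ($i=1,\dots,s$; $j=1,\dots,r$) be convex. Put $X(f)=\{(\boldsymbol{x},\boldsymbol{y}): g_i(\boldsymbol{x},\boldsymbol{y})\le 0\ (i=1,\dots,s),\ h_j(\boldsymbol{x},\boldsymbol{y})=0\ (j=1,\dots,r)\}$, $X(f(\boldsymbol{x}))=\{\boldsymbol{y}\in R^m: (\boldsymbol{x},\boldsymbol{y})\in X(f)\}$ for fixed $\boldsymbol{x}$, and $X(g)=\{(\boldsymbol{x},\boldsymbol{y})\in X(f): g(\boldsymbol{x},\boldsymbol{y})=f(\boldsymbol{x})\}$. The function $f$ is a convertible nonconvex function, written $f=[g:g_1,\dots,g_s;h_1,\dots,h_r]$, if for each $\boldsymbol{x}\in R^n$ there is $\bar{\boldsymbol{y}}\in X(f(\boldsymbol{x}))$ with $f(\boldsymbol{x})=g(\boldsymbol{x},\bar{\boldsymbol{y}})$ and $f(\boldsymbol{x})=\min_{\boldsymbol{y}\in X(f(\boldsymbol{x}))}g(\boldsymbol{x},\boldsymbol{y})$. It is a differentiable convertible nonconvex function if moreover all of $g,g_i,h_j$ are differentiable (with $s>0$); $f$ itself need not be differentiable or convex. (UOP) is the problem: minimize $f(\boldsymbol{x})$ over $\boldsymbol{x}\in R^n$. (CNP) is the problem: minimize $g(\boldsymbol{x},\boldsymbol{y})$ subject to $(\boldsymbol{x},\boldsymbol{y})\in X(f)$. Optimal solution means global optimal solution. Gradients are with respect to $(\boldsymbol{x},\boldsymbol{y})$.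 For fixed $(\boldsymbol{x},\boldsymbol{y})$, $\mathrm{(CNP)}(\boldsymbol{x},\boldsymbol{y})$ is the linear program in $\boldsymbol{d}\in R^n\times R^m$: minimize $\nabla g(\boldsymbol{x},\boldsymbol{y})^\top\boldsymbol{d}$ subject to $g_i(\boldsymbol{x},\boldsymbol{y})+\nabla g_i(\boldsymbol{x},\boldsymbol{y})^\top\boldsymbol{d}\le 0$ ($i=1,\dots,s$) and $\nabla h_j(\boldsymbol{x},\boldsymbol{y})^\top\boldsymbol{d}\le 0$ ($j=1,\dots,r$). *)

(* Defs.v *)
(* MathComp / MathComp-Analysis *)
From mathcomp Require Import all_boot all_order all_algebra.
From mathcomp Require Import all_classical all_reals all_analysis.

Set Implicit Arguments.
Unset Strict Implicit.
Unset Printing Implicit Defensive.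

Import Order.TTheory GRing.Theory Num.Theory.
Import numFieldNormedType.Exports.

Local Open Scope classical_set_scope.
Local Open Scope ring_scope.

Definition min_value (R : realType) (A : set R) (v : R) : Prop :=
  A v /\ lbound A v.

Definition optimal_solution (R : realType) (T : Type) (D : set T) (F : T -> R)
    (a : T) : Prop :=
  D a /\ forall b, D b -> F a <= F b.

Definition convex_on_space (R : realType) (V : lmodType R) (F : V -> R) : Prop :=
  @convex_function R V setT F.

Definition differentiable_on_space (R : realType) (V : normedModType R)
    (F : V -> R) : Prop :=
  forall p, differentiable F p.

Section Gradient.
Context {R : realType} {n m : nat}.
Implicit Types (F : 'rV[R]_n * 'rV[R]_m -> R) (p : 'rV[R]_n * 'rV[R]_m).

(* The vector of all n + m partial derivatives, split along R^n x R^m. *)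
Definition grad F p : 'rV[R]_n * 'rV[R]_m :=
  (\row_(i < n) 'D_((delta_mx 0 i, 0)) F p,
   \row_(j < m) 'D_((0, delta_mx 0 j)) F p).

Definition dot (a d : 'rV[R]_n * 'rV[R]_m) : R :=
  \sum_(i < n) a.1 0 i * d.1 0 i + \sum_(j < m) a.2 0 j * d.2 0 j.

End Gradient.

Section Convertible.
Context {R : realType} {n m s r : nat}.
Implicit Types (f : 'rV[R]_n -> R) (g : 'rV[R]_n * 'rV[R]_m -> R).
Implicit Types (gs : 'I_s -> 'rV[R]_n * 'rV[R]_m -> R).
Implicit Types (hs : 'I_r -> 'rV[R]_n * 'rV[R]_m -> R).

(* In the usual notation for f = [g : gs; hs], the sets feasible,
   feasible_at x and feasible_exact are X(f), X(f(x)) and X(g). *)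
Definition feasible gs hs : set ('rV[R]_n * 'rV[R]_m) :=
  [set p | (forall i, gs i p <= 0) /\ (forall j, hs j p = 0)].

Definition feasible_at gs hs (x : 'rV[R]_n) : set 'rV[R]_m :=
  [set y | feasible gs hs (x, y)].

Definition feasible_exact f g gs hs : set ('rV[R]_n * 'rV[R]_m) :=
  [set p | feasible gs hs p /\ g p = f p.1].

(* The first field says that f is nonconvex or nonsmooth.  Nothing changes if
   "smooth" is read as C^1 there, because a differentiable convex function on
   R^n is C^1. *)
Record convertible f g gs hs : Prop := Convertible {
  conv_nonconvex_or_nonsmooth :
    ~ convex_on_space f \/ ~ differentiable_on_space f;
  conv_obj_convex : convex_on_space g;
  conv_ineq_convex : forall i, convex_on_space (gs i);
  conv_eq_convex : forall j, convex_on_space (hs j);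
  conv_min : forall x,
    (exists2 y, feasible_at gs hs x y & f x = g (x, y)) /\
    min_value [set g (x, y) | y in feasible_at gs hs x] (f x) }.

Record diff_convertible f g gs hs : Prop := DiffConvertible {
  dconv_convertible : convertible f g gs hs;
  dconv_ineq_nonempty : (0 < s)%N;
  dconv_obj_diff : differentiable_on_space g;
  dconv_ineq_diff : forall i, differentiable_on_space (gs i);
  dconv_eq_diff : forall j, differentiable_on_space (hs j) }.

Definition UOP_optimal f (x : 'rV[R]_n) : Prop := optimal_solution setT f x.

Definition CNP_optimal g gs hs (p : 'rV[R]_n * 'rV[R]_m) : Prop :=
  optimal_solution (feasible gs hs) g p.

(* The constraints are linearised at p; hs j p does not appear in the second
   group because the base points of interest satisfy hs j p = 0. *)
Definition LP_feasible gs hs (p : 'rV[R]_n * 'rV[R]_m) :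
    set ('rV[R]_n * 'rV[R]_m) :=
  [set d | (forall i, gs i p + dot (grad (gs i) p) d <= 0) /\
           (forall j, dot (grad (hs j) p) d <= 0)].

Definition LP_optimal g gs hs (p d : 'rV[R]_n * 'rV[R]_m) : Prop :=
  optimal_solution (LP_feasible gs hs p) (dot (grad g p)) d.

End Convertible.

(* Main.v *)
Require Import Defs.
From mathcomp Require Import all_boot all_order all_algebra.
From mathcomp Require Import all_classical all_reals all_analysis.
From mathcomp Require Import ring lra.

(** Write p for the point (xstar, ystar).  Since the optimal value of the linear
program is nonnegative, so is its objective at every feasible direction.

A differentiable convex function lies above its tangent planes
(convex_grad_le).  Hence, for a point q feasible for the convex problem, the
linearised constraints at q - p lie below the true constraints at q, and
d = q - p is feasible for the linear program.  The same inequality for the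
objective then gives g q >= g p, which is global optimality of p.  For any x,
f x is the value of g at some feasible (x, y), and f xstar = g p, so optimality
passes from g to f.

The multipliers come from the duality of linear inequalities.  Nonnegativity of
the linear objective follows from the finitely many affine inequalities of the
linear program, which d = 0 satisfies because p is feasible.  So the
inhomogeneous Farkas lemma (affine_farkas) writes minus the gradient of g as a
nonnegative combination of the constraint gradients, with u and v as weights,
and moreover gives 0 <= \sum_i u_i g_i(p).  Every term of this sum is
nonpositive, so each of them vanishes, which is complementary slackness. *)

Set Implicit Arguments.
Unset Strict Implicit.
Unset Printing Implicit Defensive.

Import Order.TTheory GRing.Theory Num.Theory.
Import numFieldNormedType.Exports.

Local Open Scope classical_set_scope.
Local Open Scope ring_scope.

Lemma scalar0 (R : pzRingType) (V : lmodType R) (h : V -> R) :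
  scalar h -> h 0 = 0.
Proof. by move=> lh; have := lh (-1) 0 0; rewrite scaler0 addr0 mulN1r addNr. Qed.

Lemma scalarZ (R : pzRingType) (V : lmodType R) (h : V -> R) t x :
  scalar h -> h (t *: x) = t * h x.
Proof. by move=> lh; rewrite -[t *: x]addr0 lh scalar0 ?addr0. Qed.

Section Farkas.
Context {R : realFieldType} {V : lmodType R}.

(** Bartl's algebraic proof, by induction on the number of inequalities.  If the
inequality a k <= 0 cannot be dropped, some y satisfies the others and has
c y > 0, hence a k y > 0.  Projecting along y onto the kernel of a k turns the
hypothesis into one about the remaining inequalities, and undoing the
projection in the resulting identity leaves a multiple of a k.
Uniqueness of l lets the weight of its head be set without touching the tail. *)
Lemma farkas_seq (I : eqType) (l : seq I) (a : I -> V -> R) (c : V -> R) :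
  uniq l -> (forall i, scalar (a i)) -> scalar c ->
  (forall x, (forall i, i \in l -> a i x <= 0) -> c x <= 0) ->
  exists2 u : I -> R,
    forall i, 0 <= u i & forall x, c x = \sum_(i <- l) u i * a i x.
Proof.
elim: l a c => [|k l IH] a c /=.
  move=> _ _ lc hc; exists (fun=> 0) => // x; rewrite big_nil.
  have cN : c (- x) = - c x by rewrite -scaleN1r scalarZ// mulN1r.
  by apply/eqP; rewrite eq_le hc//= -oppr_le0 -cN hc.
move=> /andP[kl ul] la lc hc.
have [hl|] := pselect (forall x, (forall i, i \in l -> a i x <= 0) -> c x <= 0).
  have [u u0 cE] := IH a c ul la lc hl.
  exists (fun i => if i == k then 0 else u i) => [i|x]; first by case: ifP.
  rewrite big_cons eqxx mul0r add0r cE; apply: eq_big_seq => i il.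
  by case: eqP il kl => // -> ->.
move=> /existsNP[y /not_implyP[ay /negP]]; rewrite -ltNge => cy.
have aky : 0 < a k y.
  rewrite ltNge; apply/negP => aky; move: cy; rewrite ltNge hc// => i.
  by rewrite inE => /predU1P[->|/ay].
(* The part of x left after removing the multiple of y that makes a k vanish. *)
pose q x := - (a k x / a k y) *: y + x.
have qE b (lb : scalar b) x : b (q x) = b x - a k x / a k y * b y.
  by rewrite /q lb mulNr addrC.
have lq b : scalar b -> scalar (b \o q).
  by move=> lb t x z; rewrite /= !(qE b lb) lb la; ring.
have [||||u u0 cE] := IH (fun i => a i \o q) (c \o q) => //=.
- by move=> i; exact: lq.
- exact: lq.
- move=> x ax; apply: hc => i; rewrite inE => /predU1P[->|/ax//].
  by rewrite (qE (a k) (la k)) divfK ?subrr// gt_eqF.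
(* The coefficient of a k x in c x once c (q x) = \sum_i u i * a i (q x) is
   expanded; it is nonnegative since c y > 0 and a i y <= 0 on l. *)
pose w := (c y - \sum_(i <- l) u i * a i y) / a k y.
exists (fun i => if i == k then w else u i) => [i|x].
  case: ifP => // _; rewrite divr_ge0 ?(ltW aky)// subr_ge0.
  apply: (@le_trans _ _ 0); last exact: ltW.
  by rewrite big_seq; apply: sumr_le0 => j /ay; exact: mulr_ge0_le0.
rewrite big_cons eqxx.
rewrite (eq_big_seq (fun i => u i * a i x)); last first.
  by move=> i il; case: eqP il kl => // -> ->.
have := cE x; rewrite /= (qE c lc) => /eqP; rewrite subr_eq => /eqP ->.
under eq_bigr do rewrite (qE (a _) (la _)) mulrBr.
rewrite sumrB /w.
under [X in _ - X + _]eq_bigr do rewrite mulrCA.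
by rewrite -mulr_sumr; ring.
Qed.

Lemma farkas (I : finType) (a : I -> V -> R) (c : V -> R) :
  (forall i, scalar (a i)) -> scalar c ->
  (forall x, (forall i, a i x <= 0) -> c x <= 0) ->
  exists2 u : I -> R, forall i, 0 <= u i & forall x, c x = \sum_i u i * a i x.
Proof.
move=> la lc hc; apply: farkas_seq => //; first exact: index_enum_uniq.
by move=> x ax; apply: hc => i; apply: ax; rewrite mem_index_enum.
Qed.

End Farkas.

(** Homogenise: add a coordinate t >= 0 and apply the conical version to
b i * t + a i x.  A solution with t > 0 rescales to an affine one.  A solution
with t = 0 is a recession direction of the feasible set, and there the
conclusion uses that this set has a point x0 to start from.  The weight of the
constraint t >= 0 is the slack in e <= \sum_i u i * b i. *)
Lemma affine_farkas (R : realFieldType) (V : lmodType R) (I : finType)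
    (a : I -> V -> R) (b : I -> R) (c : V -> R) (e : R) (x0 : V) :
  (forall i, scalar (a i)) -> scalar c ->
  (forall i, b i + a i x0 <= 0) ->
  (forall x, (forall i, b i + a i x <= 0) -> e + c x <= 0) ->
  exists u : I -> R, [/\ forall i, 0 <= u i,
    forall x, c x = \sum_i u i * a i x & e <= \sum_i u i * b i].
Proof.
move=> la lc hx0 hc.
pose A (i : I + unit) (z : V * R^o) : R :=
  match i with inl i => b i * z.2 + a i z.1 | inr _ => - z.2 end.
have [|||u u0 cE] := @farkas _ _ _ A (fun z => e * z.2 + c z.1).
- by move=> [i|_] t x z /=; rewrite ?la /GRing.scale/=; ring.
- by move=> t x z /=; rewrite lc /GRing.scale/=; ring.
- move=> [x t] Axt /=.
  have ax i : b i * t + a i x <= 0 := Axt (inl i).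
  have : 0 <= t by have := Axt (inr tt); rewrite /= oppr_le0.
  rewrite le_eqVlt => /predU1P[t0|t0].
    subst t; rewrite mulr0 add0r leNgt; apply/negP => cx.
    (* The ray from x0 along x is feasible, and this l makes
       e + c (l *: x + x0) at least 1. *)
    pose l := (`|e + c x0| + 1) / c x.
    have l0 : 0 <= l by rewrite divr_ge0 ?(ltW cx)// addr_ge0.
    have : e + c (l *: x + x0) <= 0.
      apply: hc => i; rewrite la.
      have := ax i; rewrite mulr0 add0r => /(mulr_ge0_le0 l0).
      by have := hx0 i; lra.
    rewrite lc divfK ?gt_eqF// => h.
    by have := ler_norm (- (e + c x0)); rewrite normrN; lra.
  have ht (d : R) (h : V -> R) : scalar h ->
      d * t + h x = t * (d + h (t^-1 *: x)).
    by move=> lh; rewrite scalarZ// mulrDr mulrA divff ?gt_eqF// mul1r mulrC.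
  rewrite ht// pmulr_rle0//; apply: hc => i.
  by have := ax i; rewrite ht// pmulr_rle0.
exists (u \o inl); split => [i|x|]; first exact: u0.
- have := cE (x, 0); rewrite mulr0 add0r => ->.
  rewrite big_sumType /= [X in _ + X]big1 ?addr0.
    by apply: eq_bigr => i _; rewrite mulr0 add0r.
  by move=> i _; rewrite oppr0 mulr0.
- have := cE (0, 1); rewrite /= scalar0// addr0 mulr1 => ->.
  rewrite big_sumType /= -[leRHS]addr0; apply: lerD.
    by apply: ler_sum => i _; rewrite mulr1 scalar0// addr0.
  by apply: sumr_le0 => i _; rewrite mulrN1 oppr_le0.
Qed.

Section GradientInequality.
Context {R : realType} {n m : nat}.
Implicit Types (F : 'rV[R]_n * 'rV[R]_m -> R) (p q d : 'rV[R]_n * 'rV[R]_m).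

Lemma dot_scalar p : scalar (dot p).
Proof.
move=> t x y; rewrite /dot mulrDr !mulr_sumr addrACA -!big_split/=.
by congr (_ + _); apply: eq_bigr => i _; rewrite !mxE; ring.
Qed.

Lemma dotC p q : dot p q = dot q p.
Proof. by congr (_ + _); apply: eq_bigr => i _; rewrite mulrC. Qed.

Lemma dot_comb (I : finType) (u : I -> R) (a : I -> 'rV[R]_n * 'rV[R]_m) p d :
  dot (p + \sum_i u i *: a i) d = dot p d + \sum_i u i * dot (a i) d.
Proof.
have dotD x y : dot (x + y) d = dot x d + dot y d.
  by have := dot_scalar d 1 x y; rewrite scale1r mul1r !(dotC d).
have dot0 : dot 0 d = 0 by rewrite dotC (scalar0 (@dot_scalar _)).
rewrite dotD (big_morph (dot^~ d) dotD dot0).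
congr (_ + _); apply: eq_bigr => i _.
by rewrite dotC (scalarZ _ _ (@dot_scalar _)) dotC.
Qed.

Lemma dot_nondegenerate p : (forall d, dot p d = 0) -> p = 0.
Proof.
move=> /(_ p)/eqP; rewrite /dot paddr_eq0; last first.
- by apply: sumr_ge0 => i _; rewrite -expr2 sqr_ge0.
- by apply: sumr_ge0 => i _; rewrite -expr2 sqr_ge0.
rewrite !psumr_eq0; try by move=> i _; rewrite -expr2 sqr_ge0.
case: p => x y /= /andP[/allP hx /allP hy]; congr pair; apply/rowP => i.
  by have := hx i (mem_index_enum i); rewrite /= mulf_eq0 orbb mxE => /eqP.
by have := hy i (mem_index_enum i); rewrite /= mulf_eq0 orbb mxE => /eqP.
Qed.

(** Differentiability is needed: for a function that only has partial
derivatives, the vector of these need not determine the directional ones. *)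
Lemma derive_dot F p d : differentiable F p -> 'D_d F p = dot (grad F p) d.
Proof.
move=> dF; rewrite deriveE//.
have dE : d = \sum_i d.1 0 i *: (delta_mx 0 i, 0)
            + \sum_j d.2 0 j *: (0, delta_mx 0 j).
  case: d => x y; apply: injective_projections => /=.
    rewrite !raddf_sum /= [X in _ + X]big1 ?addr0.
      exact: row_sum_delta.
    by move=> i _; rewrite scaler0.
  rewrite !raddf_sum /= [X in X + _]big1 ?add0r.
    exact: row_sum_delta.
  by move=> i _; rewrite scaler0.
rewrite [in LHS]dE linearD !linear_sum /dot; congr (_ + _); apply: eq_bigr => i _.
  by rewrite linearZ /grad/= mxE deriveE// mulrC.
by rewrite linearZ /grad/= mxE deriveE// mulrC.
Qed.

(** Convexity on the segment from p to q bounds the difference quotients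
(F (p + h (q - p)) - F p) / h, for 0 < h <= 1, by F q - F p; the bound passes to
their limit as h decreases to 0. *)
Lemma convex_grad_le F p q : convex_on_space F -> differentiable F p ->
  F p + dot (grad F p) (q - p) <= F q.
Proof.
move=> cF dF; rewrite -derive_dot// -lerBrDl.
have dv : derivable F p (q - p) by exact: diff_derivable.
rewrite /derive cvg_at_rightE//; apply: limr_le.
  apply/cvg_ex; exists ('D_(q - p) F p).
  apply: cvg_trans dv; apply: cvg_app.
  by move=> A [e e0 Ae]; exists e => // x xe xgt0; apply: Ae => //; exact/lt0r_neq0.
near=> h.
have h0 : 0 < h by [].
have h1 : h <= 1 by near: h; exact: nbhs_right_le.
rewrite /GRing.scale/= ler_pdivrMl//.
have := cF (Itv01 (ltW h0) h1) q p; rewrite !inE => /(_ I I).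
have -> : conv (Itv01 (ltW h0) h1) (q : convex_lmodType _) p = h *: (q - p) + p.
  by rewrite /conv/= /unstable.onem scalerBr scalerBl scale1r -addrA [- _ + p]addrC.
rewrite convRE/= /unstable.onem.
lra.
Unshelve. all: by end_near.
Qed.
End GradientInequality.

Theorem theorem1 (R : realType) (n m s r : nat)
    (f : 'rV[R]_n -> R) (g : 'rV[R]_n * 'rV[R]_m -> R)
    (gs : 'I_s -> 'rV[R]_n * 'rV[R]_m -> R)
    (hs : 'I_r -> 'rV[R]_n * 'rV[R]_m -> R)
    (hf : diff_convertible f g gs hs)
    (xstar : 'rV[R]_n) (ystar : 'rV[R]_m)
    (hX : feasible_exact f g gs hs (xstar, ystar))
    (hLP : exists dstar : 'rV[R]_n * 'rV[R]_m,
        LP_optimal g gs hs (xstar, ystar) dstar /\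
        0 <= dot (grad g (xstar, ystar)) dstar) :
  CNP_optimal g gs hs (xstar, ystar) /\
  UOP_optimal f xstar /\
  exists (u : 'rV[R]_s) (v : 'rV[R]_r),
    (forall i, 0 <= u 0 i) /\
    (forall j, 0 <= v 0 j) /\
    grad g (xstar, ystar)
      + \sum_(i < s) u 0 i *: grad (gs i) (xstar, ystar)
      + \sum_(j < r) v 0 j *: grad (hs j) (xstar, ystar) = 0 /\
    (forall i, u 0 i * gs i (xstar, ystar) = 0).
Proof.
set p := (xstar, ystar) in hX hLP *.
case: hf => -[_ cg cgs chs fmin] _ dg dgs dhs.
case: hX => -[gsp hsp] gp; case: hLP => dstar [[_ dopt] dge0].
have LP_ge0 d : LP_feasible gs hs p d -> 0 <= dot (grad g p) d.
  by move=> /dopt; exact: le_trans.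
have CNP : CNP_optimal g gs hs p.
  split=> // q [gsq hsq].
  apply: le_trans (convex_grad_le q cg (dg p)); rewrite lerDl LP_ge0//.
  split=> [i|j]; first exact: le_trans (convex_grad_le q (cgs i) (dgs i p)) _.
  by have := convex_grad_le q (chs j) (dhs j p); rewrite hsp hsq add0r.
split=> //; split.
  split=> // x _; have [[y xy ->] _] := fmin x.
  by rewrite -[xstar]/(p.1) -gp; case: CNP => _; apply.
(* The linear program as one family of inequalities b k + A k . d <= 0. *)
pose A (k : 'I_s + 'I_r) :=
  match k with inl i => grad (gs i) p | inr j => grad (hs j) p end.
pose b (k : 'I_s + 'I_r) := if k is inl i then gs i p else 0.
have [|||x Ax|w [w0 wc wb]] :=
    @affine_farkas R _ _ (dot \o A) b (fun d => - dot (grad g p) d) 0 0.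
- by move=> k; exact: dot_scalar.
- by move=> t x y; rewrite dot_scalar; ring.
- by case=> k /=; rewrite (scalar0 (@dot_scalar _ _ _ _)) addr0.
- rewrite add0r oppr_le0; apply: LP_ge0; split=> k; first exact: (Ax (inl k)).
  by have := Ax (inr k); rewrite /= add0r.
exists (\row_i w (inl i)), (\row_j w (inr j)).
split=> [i|]; first by rewrite mxE.
split=> [j|]; first by rewrite mxE.
split.
  apply: dot_nondegenerate => d.
  have := wc d; rewrite !dot_comb big_sumType /= => wcd.
  under eq_bigr do rewrite mxE; under [X in _ + X]eq_bigr do rewrite mxE.
  by rewrite -addrA -wcd subrr.
have ub i : w (inl i) * gs i p <= 0 by exact: mulr_ge0_le0.
move: wb; rewrite big_sumType /= [X in _ + X]big1 ?addr0; last first.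
  by move=> j _; rewrite mulr0.
move=> wb i; rewrite mxE.
have : \sum_i - (w (inl i) * gs i p) == 0.
  rewrite eq_le sumrN oppr_le0 wb oppr_ge0; exact: sumr_le0.
rewrite psumr_eq0 => [/allP/(_ i (mem_index_enum _))/=|j _].
  by rewrite oppr_eq0 => /eqP.
by rewrite oppr_ge0.
Qed.
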